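(* For every integer $n \ge 2$, the shift graph $G_{2^n+1,2}$ contains a unique induced $(n+1)$-vertex-critical subgraph, namely the subgraph $G_{2^n+1,2}[W]$ induced by the vertex set \[ W = \{(x,y) : 1 \le x < y \le 2^n+1 \text{ and } \{x,y\} \subseteq I_\ell \text{ for some } \ell \in \{0,1,\dots,n\}\}, \] where $I_\ell = [\,2^\ell,\; 2^n - 2^{n-\ell} + 2\,]$ for $0 \le \ell \le n$.
   Context: For integers $p \le q$, $[p,q]$ denotes $\{p,p+1,\dots,q\}$. For an integer $N \ge 5$, the shift graph $G_{N,2}$ has as vertices the ordered pairs $(x,y)$ of integers with $1 \le x < y \le N$, and two vertices $(x,y)$ and $(y,z)$ are adjacent whenever $x<y<z$ (these are the only edges). For a vertex set $X$, $G[X]$ denotes the induced subgraph on $X$. A graph is $k$-vertex-critical if it has chromatic number $k$ and deleting any single vertex reduces its chromatic number to $k-1$. It is known that $\chi(G_{2^n+1,2}) = n+1$. *)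

(* Defs.v *)
From HB Require Import structures.
From mathcomp Require Import all_boot.

Set Implicit Arguments.
Unset Strict Implicit.
Unset Printing Implicit Defensive.

Record sgraph := SGraph {
  vertex :> finType;
  edge : rel vertex;
  edge_sym : symmetric edge;
  edge_irr : irreflexive edge }.

Section InducedSubgraph.
Variables (G : sgraph) (X : {set G}).

Definition induced_vertex : finType := {x : G | x \in X}.

Definition induced_edge : rel induced_vertex :=
  [rel u v | edge (val u) (val v)].

Fact induced_edge_sym : symmetric induced_edge.
Proof. by move=> u v; exact: edge_sym. Qed.

Fact induced_edge_irr : irreflexive induced_edge.
Proof. by move=> u; exact: edge_irr. Qed.

Definition induced : sgraph := SGraph induced_edge_sym induced_edge_irr.

End InducedSubgraph.

Definition proper_coloring (G : sgraph) (k : nat) (f : {ffun G -> 'I_k}) : bool :=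
  [forall u : G, forall v : G, edge u v ==> (f u != f v)].

Definition colorable (G : sgraph) (k : nat) : bool :=
  [exists f : {ffun G -> 'I_k}, proper_coloring f].

Fact ex_colorable (G : sgraph) : exists k, colorable G k.
Proof.
exists #|G|; apply/existsP; exists [ffun x => enum_rank x].
apply/forallP=> u; apply/forallP=> v; apply/implyP=> uv.
rewrite !ffunE (inj_eq enum_rank_inj).
by apply: contraTneq uv => ->; rewrite edge_irr.
Qed.

Definition chromatic_number (G : sgraph) : nat := ex_minn (ex_colorable G).

Definition vertex_critical (G : sgraph) (k : nat) : Prop :=
  chromatic_number G = k /\
  forall v : G, chromatic_number (induced [set~ v]) = k - 1.

Section ShiftGraph.
Variable N : nat.

Definition shift_vertex : finType :=
  {p : 'I_N.+1 * 'I_N.+1 | 1 <= p.1 < p.2}.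

Definition fst_coord (u : shift_vertex) : nat := (val u).1.
Definition snd_coord (u : shift_vertex) : nat := (val u).2.

Definition shift_edge : rel shift_vertex :=
  [rel u v | (snd_coord u == fst_coord v) || (snd_coord v == fst_coord u)].

Fact shift_edge_sym : symmetric shift_edge.
Proof. by move=> u v; exact: orbC. Qed.

Fact shift_edge_irr : irreflexive shift_edge.
Proof.
move=> u; rewrite /shift_edge /= orbb; apply: negbTE; rewrite neq_ltn orbC.
by case/andP: (valP u) => _ ->.
Qed.

Definition shift_graph : sgraph := SGraph shift_edge_sym shift_edge_irr.

End ShiftGraph.

(* The interval I_l; no truncation occurs in the subtractions when l <= n. *)
Definition I_interval (n l : nat) : pred nat :=
  [pred x | 2 ^ l <= x <= 2 ^ n - 2 ^ (n - l) + 2].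

Definition W_set (n : nat) : {set shift_graph (2 ^ n + 1)} :=
  [set u : shift_graph (2 ^ n + 1) |
    [exists l : 'I_n.+1,
      (fst_coord u \in I_interval n l) && (snd_coord u \in I_interval n l)]].

(* Main.v *)
Require Import Defs.
From mathcomp Require Import all_boot.
From mathcomp Require Import zify_ssreflect.
Import SsreflectZifyInstances.Exports.

(** A k-colouring of G[X] is the same as a family of sets A_x of colours with
    A_x not included in A_y for each (x, y) in X. Both halves of the theorem
    follow from: G[X] is not n-colourable iff W is included in X.

    If (a, b) is in W, with a and b in I_l, let S be a set of n - l colours.
    There are 2^l - 1 proper supersets of S to place before a and
    2^(n-l) - 1 proper subsets to place after b, so S can be used at both a and
    b in a linear extension of reverse inclusion, and the only bad pair is (a, b).

    Conversely, among the families for W take one with large A_x for x at most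
    t = 2^(n-1) + 1 and small A_x for x > t. Every proper superset of A_x with
    x <= t then occurs before x, so that 2^(n - |A_x|) <= x, and dually for
    x > t. These bounds put every pair with A_x included in A_y in a common I_l,
    so the family is good for all pairs; but 2^n + 1 distinct sets of n
    colours do not exist. *)

Set Implicit Arguments.
Unset Strict Implicit.
Unset Printing Implicit Defensive.

(** * Colourability and vertex deletion in general graphs *)

Lemma colorableP (G : sgraph) (k : nat) :
  reflect (exists f : G -> 'I_k, forall u v, edge u v -> f u != f v)
          (colorable G k).
Proof.
apply: (iffP existsP) => [[f /forallP fP]|[f fP]].
  by exists f => u v uv; have /forallP/(_ v)/implyP := fP u; apply.
exists (finfun f); apply/forallP=> u; apply/forallP=> v.
by apply/implyP=> uv; rewrite !ffunE fP.
Qed.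

Lemma colorable_hom (G H : sgraph) (h : G -> H) (k : nat) :
  (forall u v, edge u v -> edge (h u) (h v)) -> colorable H k -> colorable G k.
Proof.
move=> hE /colorableP[f fP]; apply/colorableP; exists (f \o h) => u v uv.
exact/fP/hE.
Qed.

Lemma colorable_leq (G : sgraph) (j k : nat) :
  j <= k -> colorable G j -> colorable G k.
Proof.
move=> le_jk /colorableP[f fP]; apply/colorableP.
exists (fun u => widen_ord le_jk (f u)) => u v uv.
by apply: contra (fP u v uv) => /eqP[/eqP].
Qed.

Lemma colorable_induced_subset (G : sgraph) (X Y : {set G}) (k : nat) :
  X \subset Y -> colorable (induced Y) k -> colorable (induced X) k.
Proof.
move=> /subsetP sXY.
by apply: (@colorable_hom _ _
  (fun u : induced X => exist _ (val u) (sXY _ (valP u)) : induced Y)).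
Qed.

Lemma colorable_addv (G : sgraph) (v : G) (k : nat) :
  colorable (induced [set~ v]) k -> colorable G k.+1.
Proof.
case/colorableP=> f fP; apply/colorableP.
pose g (u : G) : 'I_k.+1 :=
  if insub u is Some w then lift ord0 (f w) else ord0.
have gE (u : induced [set~ v]) : g (val u) = lift ord0 (f u).
  by rewrite /g valK.
have gv : g v = ord0 by rewrite /g insubN // !inE eqxx.
exists g => x y xy; have [xv|xNv] := eqVneq x v; have [yv|yNv] := eqVneq y v.
- by rewrite xv yv edge_irr in xy.
- have yP : y \in [set~ v] by rewrite !inE.
  by rewrite xv gv (gE (exist _ y yP)) eq_sym lift_eqF.
- have xP : x \in [set~ v] by rewrite !inE.
  by rewrite yv gv (gE (exist _ x xP)) lift_eqF.
have xP : x \in [set~ v] by rewrite !inE.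
have yP : y \in [set~ v] by rewrite !inE.
rewrite (gE (exist _ x xP)) (gE (exist _ y yP)) (inj_eq lift_inj).
exact: fP.
Qed.

Lemma chromatic_numberS (G : sgraph) (k : nat) :
  chromatic_number G = k.+1 <-> colorable G k.+1 /\ ~~ colorable G k.
Proof.
rewrite /chromatic_number; case: ex_minnP => m Gm m_min; split.
  by move=> em; rewrite -em Gm; split=> //; apply/negP=> /m_min; rewrite em ltnn.
case=> /m_min le_m; rewrite leq_eqVlt ltnS in le_m => NGk.
case/orP: le_m => [/eqP //|/colorable_leq/(_ Gm)]; by rewrite (negPf NGk).
Qed.

Lemma colorable_chromatic_number (G : sgraph) : colorable G (chromatic_number G).
Proof. by rewrite /chromatic_number; case: ex_minnP. Qed.

(** * Vertices of the shift graph as arcs, and colourings as families of sets *)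

Definition arc (N : nat) (X : {set shift_graph N}) : rel 'I_N.+1 :=
  [rel x y | [exists u in X, val u == (x, y)]].

Definition set_coloring (m k : nat) (r : rel 'I_m) (A : 'I_m -> {set 'I_k}) :=
  forall x y, r x y -> ~~ (A x \subset A y).

Lemma arc_lt (N : nat) (X : {set shift_graph N}) (x y : 'I_N.+1) :
  arc X x y -> 0 < x < y.
Proof. by case/exists_inP=> u _ /eqP e; have := valP u; rewrite e. Qed.

(* The set at x collects the colours of the vertices (x, _). *)
Lemma colorable_set_coloring (N k : nat) (X : {set shift_graph N}) :
  colorable (induced X) k <->
  exists A : 'I_N.+1 -> {set 'I_k}, set_coloring (arc X) A.
Proof.
split=> [/colorableP[f fP]|[A AP]].
  exists (fun x => [set c | [exists u : induced X,
    ((val (val u)).1 == x) && (f u == c)]]) => x y /exists_inP[u uX /eqP uxy].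
  pose w : induced X := exist _ u uX.
  apply/subsetPn; exists (f w).
    by rewrite inE; apply/existsP; exists w; rewrite (congr1 fst uxy) !eqxx.
  rewrite inE; apply/existsP=> -[v /andP[/eqP vy /eqP fvw]].
  have /fP : edge w v 
    by apply/orP; left; rewrite /snd_coord /fst_coord vy (congr1 snd uxy).
  by rewrite fvw eqxx.
apply/colorableP.
(* An arc (x, y) may take any colour of [A x] outside [A y]; a following arc (y, z) takes one inside
   [A y], so the two differ. *)
have exc (u : induced X) : exists c,
    (c \in A (val (val u)).1) && (c \notin A (val (val u)).2).
  have /AP/subsetPn[c c1 c2] : arc X (val (val u)).1 (val (val u)).2.
    by apply/exists_inP; exists (val u); rewrite ?(valP u) -?surjective_pairing.
  by exists c; rewrite c1.
exists (fun u => xchoose (exc u)).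
suff sep (u v : induced X) : (val (val u)).2 = (val (val v)).1 ->
    xchoose (exc u) != xchoose (exc v).
  move=> u v /orP[] /eqP e; last rewrite eq_sym; exact/sep/val_inj.
move=> e; apply: contraTneq (xchooseP (exc v)) => <-.
by rewrite -e negb_and (proj2 (andP (xchooseP (exc u)))).
Qed.

(** * Locally optimal families and their size bounds *)

Lemma card_supsets (n : nat) (S : {set 'I_n}) :
  #|[set C : {set 'I_n} | S \subset C]| = 2 ^ (n - #|S|).
Proof.
have -> : [set C : {set 'I_n} | S \subset C] = (@setC _) @: powerset (~: S).
  apply/setP=> C; rewrite inE; apply/idP/imsetP => [sSC|[D DS ->]].
    by exists (~: C); rewrite ?setCK // inE setCS.
  by rewrite inE in DS; rewrite subsetC.
rewrite card_imset ?card_powerset 1?cardsCs ?setCK ?card_ord //.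
exact: setC_inj.
Qed.

Lemma card_ord_itv (m a b : nat) : #|[set w : 'I_m | a <= w < b]| <= b - a.
Proof.
rewrite -[leqRHS](size_iota a) cardE -(size_map val).
apply: uniq_leq_size; first by rewrite (map_inj_uniq val_inj) enum_uniq.
move=> _ /mapP[w + ->]; rewrite mem_enum inE mem_iota /=; lia.
Qed.

(** Take a set colouring maximising the sum of the sizes up to [t] and of the co-sizes beyond [t].
    Changing one value so as to raise this sum must violate an arc at that position, and the other
    end of this arc is the blocker. *)
Lemma set_coloring_local_opt (m n t : nat) (r : rel 'I_m)
    (A0 : 'I_m -> {set 'I_n}) :
  irreflexive r -> set_coloring r A0 ->
  exists A : 'I_m -> {set 'I_n}, [/\ set_coloring r A,
    forall (z : 'I_m) (C : {set 'I_n}), z <= t -> A z \proper C ->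
      exists2 w, r w z & A w \subset C
  & forall (z : 'I_m) (C : {set 'I_n}), t < z -> C \proper A z ->
      exists2 w, r z w & C \subset A w].
Proof.
move=> r_irr A0P.
pose P (A : {ffun 'I_m -> {set 'I_n}}) :=
  [forall x, forall y, r x y ==> ~~ (A x \subset A y)].
pose wt (x : 'I_m) (C : {set 'I_n}) := if x <= t then #|C| else n - #|C|.
pose phi (A : {ffun 'I_m -> {set 'I_n}}) := \sum_x wt x (A x).
have PP (A : {ffun 'I_m -> {set 'I_n}}) : reflect (set_coloring r A) (P A).
  apply: (iffP forallP) => [H x y rxy|H x].
    by have /forallP/(_ y)/implyP := H x; apply.
  by apply/forallP=> y; apply/implyP/H.
have PA0 : P (finfun A0) by apply/PP=> x y; rewrite !ffunE; exact: A0P.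
case: (arg_maxnP phi PA0) => A /PP AP A_max.
have change z C : wt z (A z) < wt z C ->
    (exists2 w, r w z & A w \subset C) \/ (exists2 w, r z w & C \subset A w).
  move=> lt_wt; pose B := [ffun x => if x == z then C else A x].
  have : ~~ P B.
    apply/negP=> /A_max; apply/negP; rewrite -ltnNge /phi.
    rewrite (bigD1 z) //= [ltnRHS](bigD1 z) //= !ffunE eqxx.
    rewrite -addSn leq_add // eq_leq //.
    by apply: eq_bigr => x /negPf xz; rewrite !ffunE xz.
  rewrite negb_forall => /existsP[x]; rewrite negb_forall => /existsP[y].
  rewrite negb_imply negbK !ffunE => /andP[rxy].
  case: (eqVneq x z) => [xz|_]; case: (eqVneq y z) => [yz|_] sub.
  - by rewrite xz yz r_irr in rxy.
  - by right; exists y; rewrite -?xz.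
  - by left; exists x; rewrite -?yz.
  - by have := AP x y rxy; rewrite sub.
exists A; split=> // z C tz pC.
  case: (change z C); first by rewrite /wt tz proper_card.
    by case=> w; exists w.
  (* A violated arc leaving [z] would already be violated by [A], since [A z] is included in [C]. *)
  case=> w rzw sCw; have := AP z w rzw.
  by rewrite (subset_trans (proper_sub pC) sCw).
case: (change z C).
- rewrite /wt [z <= t]leqNgt tz /=.
  have le_n : #|A z| <= n by rewrite -[leqRHS]card_ord max_card.
  have lt_C := proper_card pC.
  exact: ltn_sub2l (leq_trans lt_C le_n) lt_C.
- case=> w rwz sCw; have := AP w z rwz.
  by rewrite (subset_trans sCw (proper_sub pC)).
- by case=> w; exists w.
Qed.

(* Every proper superset C of A z is blocked by an in-neighbour w with
   A w included in C; descending along these blockers ends at a w with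
   A w = C. *)
Lemma leq_card_supsets (m n t : nat) (r : rel 'I_m) (A : 'I_m -> {set 'I_n}) :
  (forall x y, r x y -> 0 < x < y) ->
  (forall (z : 'I_m) (C : {set 'I_n}), z <= t -> A z \proper C ->
     exists2 w, r w z & A w \subset C) ->
  forall z : 'I_m, 0 < z <= t -> 2 ^ (n - #|A z|) <= z.
Proof.
move=> r_lt blocked z /andP[z0 zt].
have appear k (x : 'I_m) (C : {set 'I_n}) : x < k -> 0 < x <= t ->
    A x \subset C -> exists2 w : 'I_m, 0 < w <= x & A w = C.
  elim: k x => // k IH x; rewrite ltnS => xk /andP[x0 xt] sAC.
  have [eAC|nAC] := eqVneq (A x) C; first by exists x; rewrite ?x0 /=.
  have [|w /r_lt/andP[w0 wx] sw] := blocked x C xt.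
    by rewrite properEneq nAC.
  have [||v /andP[v0 vw] <-] := IH w _ _ sw; try lia.
  by exists v => //; lia.
rewrite -card_supsets.
apply: leq_trans (_ : #|A @: [set w : 'I_m | 1 <= w < z.+1]| <= _).
  apply/subset_leq_card/subsetP=> C; rewrite inE => sAC.
  have [||w wz <-] := appear z.+1 z C _ _ sAC; rewrite ?ltnSn ?z0 //.
  by apply: imset_f; rewrite inE ltnS.
apply: leq_trans (leq_imset_card _ _) _.
by apply: leq_trans (card_ord_itv _ _ _) _; rewrite subn1.
Qed.

(** Dual count: the blockers lie to the right, so every subset of [A z] is the value at one of the
    [m - z] positions from [z] on. *)
Lemma leq_card_subsets (m n t : nat) (r : rel 'I_m) (A : 'I_m -> {set 'I_n}) :
  (forall x y, r x y -> 0 < x < y) ->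
  (forall (z : 'I_m) (C : {set 'I_n}), t < z -> C \proper A z ->
     exists2 w, r z w & C \subset A w) ->
  forall z : 'I_m, t < z -> 2 ^ #|A z| <= m - z.
Proof.
move=> r_lt blocked z tz.
have appear k (x : 'I_m) (C : {set 'I_n}) : m - x < k -> t < x ->
    C \subset A x -> exists2 w : 'I_m, x <= w & A w = C.
  elim: k x => // k IH x xk tx sAC.
  have [eAC|nAC] := eqVneq C (A x); first by exists x.
  have [|w /r_lt/andP[x0 xw] sw] := blocked x C tx.
    by rewrite properEneq nAC.
  have [||v wv <-] := IH w _ _ sw; try by have := ltn_ord w; lia.
  by exists v => //; lia.
rewrite -card_powerset.
apply: leq_trans (_ : #|A @: [set w : 'I_m | z <= w < m]| <= _).
  apply/subset_leq_card/subsetP=> C; rewrite inE => sAC.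
  have [||w wz <-] := appear (m - z).+1 z C _ _ sAC; rewrite ?ltnSn //.
  by apply: imset_f; rewrite inE wz ltn_ord.
by apply: leq_trans (leq_imset_card _ _) _; rewrite card_ord_itv.
Qed.

(** * The graph induced by W has no colouring with n colours *)

Lemma arc_W (n l : nat) (x y : 'I_(2 ^ n + 1).+1) :
  l <= n -> 2 ^ l <= x -> x < y -> y <= 2 ^ n - 2 ^ (n - l) + 2 ->
  arc (W_set n) x y.
Proof.
move=> ln lx xy yl; have l0 : 0 < 2 ^ l by rewrite expn_gt0.
have xyP : 1 <= (x, y).1 < (x, y).2 by rewrite /=; lia.
apply/exists_inP; exists (exist _ (x, y) xyP : shift_graph _) => //.
rewrite inE; apply/existsP; exists (Ordinal (ln : l < n.+1)).
by rewrite !inE /fst_coord /snd_coord /=; lia.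
Qed.

Lemma W_not_colorable (n : nat) : 0 < n -> ~~ colorable (induced (W_set n)) n.
Proof.
(* From here on [n1] is the number of colours and [n] is one less, so the cut is at [2 ^ n + 1]. *)
case: n => // n _; set n1 := n.+1.
apply/negP=> /colorable_set_coloring[A0 A0P].
have r_lt x y : arc (W_set n1) x y -> 0 < x < y by apply: arc_lt.
have r_irr : irreflexive (arc (W_set n1)).
  by move=> x; apply/negbTE/negP=> /r_lt/andP[_]; rewrite ltnn.
have [A [AP up down]] := set_coloring_local_opt (2 ^ n + 1) r_irr A0P.
have {}up := leq_card_supsets r_lt up.
have {}down := leq_card_subsets r_lt down.
have n0 : 0 < 2 ^ n by rewrite expn_gt0.
have n1E : 2 ^ n1 = 2 ^ n + 2 ^ n by rewrite expnS mul2n addnn.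
have cardA x : #|A x| <= n1 by rewrite -[leqRHS]card_ord max_card.
have lt2 : 2 < (2 ^ n1 + 1).+1 by lia.
have ltm : 2 ^ n1 < (2 ^ n1 + 1).+1 by lia.
have all_pairs (x y : 'I_(2 ^ n1 + 1).+1) :
    0 < x -> x < y -> ~~ (A x \subset A y).
  move=> x0 xy; apply/negP=> sA; have yN := ltn_ord y.
  have cA := subset_leq_card sA.
  have arcF : ~~ arc (W_set n1) x y by apply/negP=> /AP; rewrite sA.
  case: (leqP y (2 ^ n + 1)) => yt.
    (* Left of the cut: [I_interval n1 1] is [2, [2 ^ n + 2]], so only x = 1 escapes it. *)
    case: (leqP 2 x) => x2.
      case/negP: arcF; apply: (@arc_W n1 1) => //; rewrite ?subn1 /=; lia.
    have x1 : x = 1 :> nat by lia.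
    (* The bound at position 1 makes [A x], hence [A y], full. This contradicts the arc (2, y)
       unless y = 2, and (1, 2) is itself an arc, by l = 0. *)
    have cx : n1 - #|A x| <= 0.
      by rewrite -(@leq_exp2l 2) // expn0 -{2}x1; apply: up; lia.
    have yT : A y = setT.
      apply/eqP; rewrite eqEcard subsetT cardsT card_ord; lia.
    case: (ltnP 2 y) => y2.
      have /AP : arc (W_set n1) (Ordinal lt2) y.
        by apply: (@arc_W n1 1) => //; rewrite ?subn1 /=; lia.
      by rewrite yT subsetT.
    by case/negP: arcF; apply: (@arc_W n1 0) => //; rewrite ?subn0 ?expn0; lia.
  case: (leqP x (2 ^ n + 1)) => xt.
    (* Here l is the number of colours missing from [A x]: the bound at x gives the left end of the
       interval, the bound at y and [#|A x| <= #|A y|] the right end. *)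
    case/negP: arcF; apply: (@arc_W n1 (n1 - #|A x|)); rewrite ?leq_subr //.
      by apply: up; lia.
    rewrite subKn //; have := down y yt.
    have : 2 ^ #|A x| <= 2 ^ #|A y| by rewrite leq_exp2l.
    have : 2 ^ #|A x| <= 2 ^ n1 by rewrite leq_exp2l.
    lia.
  (* Right of the cut: [I_interval n1 n] ends at [2 ^ n1], so only the last position escapes it.
     There [A y], hence [A x], is empty, against the arc from x to [2 ^ n1]; if x is [2 ^ n1], then
     l = [n1] serves. *)
  case: (leqP y (2 ^ n1)) => yn.
    by case/negP: arcF; apply: (@arc_W n1 n) => //; rewrite ?subSnn /=; lia.
  have := down y yt.
  have -> : (2 ^ n1 + 1).+1 - y = 2 ^ 0 by rewrite expn0; lia.
  rewrite leq_exp2l // leqn0 cards_eq0 => /eqP Ay.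
  have Ax : A x = set0 by apply/eqP; rewrite -subset0 -Ay.
  case: (ltnP x (2 ^ n1)) => xn.
    have /AP : arc (W_set n1) x (Ordinal ltm).
      by apply: (@arc_W n1 n) => //; rewrite ?subSnn /=; lia.
    by rewrite Ax sub0set.
  by case/negP: arcF; apply: (@arc_W n1 n1) => //; rewrite ?subnn ?expn0; lia.
(* [lift ord0] skips position 0, leaving [2 ^ n1 + 1] positions for [2 ^ n1] sets. *)
have inj : injective (A \o lift ord0).
  move=> x y /= eA; apply: (@lift_inj _ ord0); apply/val_inj.
  case: (ltngtP (lift ord0 x) (lift ord0 y)) => // lt_xy.
    by have := all_pairs (lift ord0 x) _ isT lt_xy; rewrite eA subxx.
  by have := all_pairs (lift ord0 y) _ isT lt_xy; rewrite eA subxx.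
have := leq_card _ inj.
rewrite card_ord -cardsT -powersetT card_powerset cardsT card_ord; lia.
Qed.

(** * Colouring the shift graph after deleting a vertex of W *)

(* A linear extension of reverse inclusion on the sets other than S that lists
   the supersets of S first and the subsets of S last. *)
Lemma supset_first_enum (n : nat) (S : {set 'I_n}) :
  exists L : nat -> {set 'I_n}, [/\
    forall i j, i < j -> j < 2 ^ n - 1 -> ~~ (L i \subset L j),
    forall i, i < 2 ^ n - 1 -> S \subset L i -> i.+1 < 2 ^ (n - #|S|)
  & forall i, i < 2 ^ n - 1 -> L i \subset S -> 2 ^ n <= i + 2 ^ #|S|].
Proof.
pose cls (T : {set 'I_n}) :=
  if S \subset T then 0 else if T \subset S then 2 else 1.
(* A lexicographic key: [n - #|T|] is below [n.+1], so the class decides first, then decreasing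
   size. *)
pose key (T : {set 'I_n}) := cls T * n.+1 + (n - #|T|).
pose s := sort (relpre key leq) (enum [set~ S]).
have size_s : size s = 2 ^ n - 1.
  rewrite size_sort -cardE cardsCs setCK cards1.
  by rewrite -cardsT -powersetT card_powerset cardsT card_ord.
have s_uniq : uniq s by rewrite sort_uniq enum_uniq.
have s_mem T : (T \in s) = (T != S) by rewrite mem_sort mem_enum !inE.
have cardS (T : {set 'I_n}) : #|T| <= n by rewrite -[leqRHS]card_ord max_card.
have s_sorted i j : i <= j -> j < size s -> key (nth S s i) <= key (nth S s j).
  move=> ij js; apply: (@sorted_leq_nth _ (relpre key leq)) => //.
  - by move=> x y z; exact: leq_trans.
  - by move=> x /=.
  - by apply: sort_sorted => x y; exact: leq_total.
  - by rewrite inE; exact: leq_ltn_trans js.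
have key_cls (T U : {set 'I_n}) : key T <= key U -> cls T <= cls U.
  rewrite /key; have := cardS T; have := cardS U; nia.
have key_sub (T U : {set 'I_n}) : T \proper U -> key U < key T.
  move=> pTU; have sTU := proper_sub pTU; have lt_c := proper_card pTU.
  have : cls U <= cls T.
    rewrite /cls; case: (boolP (S \subset T)) => [ST|_].
      by rewrite (subset_trans ST sTU).
    case: ifP => // _; case: (boolP (U \subset S)) => [US|_].
      by rewrite (subset_trans sTU US).
    by case: ifP.
  have lt_n : n - #|U| < n - #|T|.
    exact: ltn_sub2l (leq_trans lt_c (cardS U)) lt_c.
  by move=> le_c; rewrite /key -addnS leq_add // leq_mul2r le_c orbT.
exists (nth S s); rewrite -size_s; split=> [i j ij js|i i_s Si|i i_s iS].
- apply/negP=> sub; have is_ := ltn_trans ij js.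
  have := s_sorted i j (ltnW ij) js; rewrite leqNgt => /negP[].
  apply: key_sub; rewrite properEneq sub andbT.
  by rewrite nth_uniq // ltn_eqF.
(* The first [i.+1] sets of the list are all proper supersets of [S]. *)
- rewrite -card_supsets (cardsD1 S) inE subxx add1n ltnS.
  rewrite -(size_takel i_s) cardE uniq_leq_size ?take_uniq //.
  move=> T Tt; rewrite mem_enum !inE -s_mem (mem_take Tt) /=.
  have /(nthP S)[j] := Tt; rewrite size_takel // ltnS => ji.
  rewrite nth_take ?ltnS // => <-.
  have /key_cls := s_sorted j i ji i_s.
  by rewrite /cls Si leqn0; case: (S \subset _) => //; case: ifP.
- have : size (drop i s) < 2 ^ #|S|.
    rewrite -card_powerset (cardsD1 S) inE subxx add1n ltnS.
    rewrite cardE uniq_leq_size ?drop_uniq //.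
    move=> T Tt; rewrite mem_enum !inE -s_mem (mem_drop Tt) /=.
    have /(nthP S)[j] := Tt; rewrite size_drop nth_drop => js <-.
    have ijs : i + j < size s by rewrite -ltn_subRL.
    have /key_cls := s_sorted i (i + j) (leq_addr _ _) ijs.
    have : nth S s i != S by rewrite -s_mem mem_nth.
    rewrite /cls iS eqEsubset iS /= => /negPf ->.
    by case: (S \subset _) => //; case: ifP.
  rewrite size_drop; lia.
Qed.

(** Positions start at 1 and indices of [L] at 0, so the shift is 1 before [a], 2 between the copies
    of [S], and 3 after [b]. *)
Definition insert_twice (T : Type) (L : nat -> T) (S : T) (a b x : nat) : T :=
  if x < a then L x.-1 else if x == a then S
  else if x < b then L x.-2 else if x == b then S else L (x - 3).

(** [L i] comes after the first copy of [S] exactly when [a <= i.+1], and before the second exactly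
    when [i.+2 < b]. *)
Lemma insert_twiceP (T : Type) (r : rel T) (L : nat -> T) (S : T) (a b m : nat) :
  0 < a < b ->
  (forall i j, i < j -> j < m -> ~~ r (L i) (L j)) ->
  (forall i, i < m -> a <= i.+1 -> ~~ r S (L i)) ->
  (forall i, i < m -> i.+2 < b -> ~~ r (L i) S) ->
  forall x y, 0 < x -> x < y -> y < m.+3 -> b < m.+3 -> (x, y) != (a, b) ->
  ~~ r (insert_twice L S a b x) (insert_twice L S a b y).
Proof.
move=> /andP[a0 ab] Ldec LS SL x y x0 xy ym bm; rewrite xpair_eqE /insert_twice.
case: (ltngtP x a) => xa; case: (ltngtP y a) => ya; try by lia.
- by move=> _; apply: Ldec; lia.
- by case: (ltngtP y b) => yb _; [apply: Ldec | apply: Ldec | apply: SL]; lia.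
- by move=> _; apply: SL; lia.
- case: (ltngtP x b) => xb; case: (ltngtP y b) => yb _; try by lia.
  + by apply: Ldec; lia.
  + by apply: Ldec; lia.
  + by apply: SL; lia.
  + by apply: Ldec; lia.
  + by apply: LS; lia.
- by case: (ltngtP y b) => yb //= _; apply: LS; lia.
Qed.

(* S, of size n - l, is used twice, at a and at b, where a vertex (a, b) of W
   leaves exactly enough room for the supersets of S before a and for the
   subsets of S after b. *)
Lemma shift_graph_delete_W_colorable (n : nat) (u : shift_graph (2 ^ n + 1)) :
  u \in W_set n -> colorable (induced [set~ u]) n.
Proof.
rewrite inE => /existsP[l]; rewrite !inE => /andP[/andP[la _] /andP[_ bl]].
have ln : l <= n by rewrite -ltnS.
have /andP[a1 ab] : 0 < fst_coord u < snd_coord u := valP u.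
set a := fst_coord u in la a1 ab; set b := snd_coord u in bl ab.
pose S := [set i in take (n - l) (enum 'I_n)].
have cardS : #|S| = n - l.
  rewrite cardsE; move/card_uniqP: (take_uniq (n - l) (enum_uniq 'I_n)) => ->.
  by rewrite size_takel // size_enum_ord leq_subr.
have [L [Ldec Lsup Lsub]] := supset_first_enum S.
(* After this, supersets of [S] have indices below [2 ^ l - 1] and subsets have indices from
   [2 ^ n - 2 ^ (n - l)] on, matching the two ends of I_l. *)
rewrite cardS subKn // in Lsup; rewrite cardS in Lsub.
have n0 : 0 < 2 ^ n by rewrite expn_gt0.
have mE : (2 ^ n - 1).+3 = (2 ^ n + 1).+1 by rewrite subn1 prednK // addn1.
apply/colorable_set_coloring.
exists (fun x : 'I_(2 ^ n + 1).+1 => insert_twice L S a b x) => x y xy.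
have /andP[x0 lt_xy] := arc_lt xy.
apply: (@insert_twiceP _ (fun B C : {set 'I_n} => B \subset C) _ _ _ _
  (2 ^ n - 1)) => //.
- by rewrite a1.
- move=> i i_n ai; apply/negP=> /(Lsup _ i_n); rewrite ltnNge => /negP[].
  exact: leq_trans la ai.
- move=> i i_n ib; apply/negP=> /(Lsub _ i_n) le_n.
  have := leq_trans ib bl.
  by rewrite addn2 !ltnS ltnNge leq_subLR addnC le_n.
- by rewrite mE.
- by rewrite mE; exact: ltn_ord.
(* The exempt pair (a, b) is the deleted vertex [u]. *)
apply/eqP=> -[xa yb]; case/exists_inP: xy => w; rewrite !inE => wu /eqP wxy.
case/eqP: wu; apply/val_inj; rewrite wxy [RHS]surjective_pairing.
by congr pair; apply/val_inj.
Qed.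

(** * Criticality and uniqueness *)

Theorem theorem1 (n : nat) (hn : 2 <= n) :
  vertex_critical (induced (W_set n)) (n + 1) /\
  (forall X : {set shift_graph (2 ^ n + 1)},
     vertex_critical (induced X) (n + 1) -> X = W_set n).
Proof.
have n0 : 0 < n by lia.
have WN := W_not_colorable n0; have e1 : n + 1 - 1 = n by lia.
rewrite /vertex_critical e1 (addn1 n).
have Wdel (v : induced (W_set n)) : colorable (induced [set~ v]) n.
  have hP (w : induced [set~ v]) : val (val w) \in [set~ val v].
    by have := valP w; rewrite !inE (inj_eq val_inj).
  pose h (w : induced [set~ v]) : induced [set~ val v] :=
    exist _ (val (val w)) (hP w).
  have hE (w1 w2 : induced [set~ v]) : edge w1 w2 -> edge (h w1) (h w2) by [].
  exact: (colorable_hom hE (shift_graph_delete_W_colorable (valP v))).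
split; first split.
- apply/chromatic_numberS; split=> //.
  case: (pickP (mem (W_set n))) => [u uW|W0].
    exact: colorable_addv (Wdel (exist _ u uW)).
  apply/colorableP; exists (fun=> ord0) => -[u uW].
  by have := W0 u; rewrite /= uW.
- move=> v; case: n n0 hn WN Wdel v {e1} => // n _ _ WN Wdel v.
  apply/chromatic_numberS; split; first exact: Wdel.
  by apply: contra WN; exact: colorable_addv.
move=> X [/chromatic_numberS[_ XN] Xdel].
(* If X misses some u in W, it lies in the complement of u, which is n-colourable. *)
have WX : W_set n \subset X.
  apply/subsetP=> u uW; apply: contraNT XN => uX.
  apply: colorable_induced_subset (shift_graph_delete_W_colorable uW).
  by rewrite subsetC sub1set inE.
(* If X has a vertex v outside W, criticality makes X without v n-colourable, although it still
   contains W. *)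
apply/eqP; rewrite eq_sym eqEsubset WX /=; apply/subsetP=> v vX.
apply: contraNT WN => vW; pose v' : induced X := exist _ v vX.
have := colorable_chromatic_number (induced [set~ v']); rewrite Xdel.
pose g (w : induced (W_set n)) : induced X :=
  exist _ (val w) (subsetP WX _ (valP w)).
have hP w : g w \in [set~ v'].
  by rewrite !inE -val_eqE /=; apply: contraNneq vW => <-; exact: valP.
pose h (w : induced (W_set n)) : induced [set~ v'] := exist _ (g w) (hP w).
have hE (w1 w2 : induced (W_set n)) : edge w1 w2 -> edge (h w1) (h w2) by [].
exact: (colorable_hom hE).
Qed.
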